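(* Let $\kappa\in(0,1]$ and $\epsilon,\delta>0$. No (possibly randomized) polynomial-time algorithm with value-oracle access achieves an approximation factor strictly better than $\frac{n^{1-3\epsilon}}{2+(n^{1-3\epsilon}-2)(1-\kappa)+2\delta\kappa}$ for the minimum submodular perfect matching problem with submodular functions of curvature $\kappa$: given a graph $\mathcal G=(\mathcal V,\mathcal E)$ with $n=|\mathcal V|$ and a nonnegative monotone submodular $f:2^{\mathcal E}\to\mathbb{R}$ with $f(\emptyset)=0$ and curvature $\kappa$, find a perfect matching $X\subseteq\mathcal E$ minimizing $f(X)$.
   Context: In the value-oracle model the algorithm accesses $f$ only by queries returning $f(S)$; polynomial-time means polynomial in the size of the graph. Curvature: $\kappa_f = 1-\min_{e\in\mathcal E}\frac{f(e\mid \mathcal E\setminus\{e\})}{f(\{e\})}$ with $f(e\mid S)=f(S\cup\{e\})-f(S)$. *)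

(* Defs.v *)
From HB Require Import structures.
From mathcomp Require Import all_boot all_order all_algebra.
From mathcomp Require Import all_classical all_reals all_analysis.

Set Implicit Arguments.
Unset Strict Implicit.
Unset Printing Implicit Defensive.

Import Order.TTheory GRing.Theory Num.Theory.
Local Open Scope ring_scope.

(* A graph on the vertex set 'I_n is given by its set E of edges, each edge being
   a two-element set of vertices. Set functions are only ever constrained, and
   only ever queried, on subsets of E. *)
Section Problem.
Variables (R : realType) (n : nat).
Implicit Types (E X Y : {set {set 'I_n}}) (f : {set {set 'I_n}} -> R).

Definition simple_graph E : Prop := forall e, e \in E -> #|e| = 2%N.

Definition perfect_matching E X : bool :=
  (X \subset E) && [forall v : 'I_n, #|[set e in X | v \in e]| == 1%N].

Definition monotone_on E f : Prop :=
  forall X Y, X \subset Y -> Y \subset E -> f X <= f Y.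

Definition submodular_on E f : Prop :=
  forall X Y, X \subset E -> Y \subset E -> f (X :|: Y) + f (X :&: Y) <= f X + f Y.

Definition marginal f (e : {set 'I_n}) X : R := f (e |: X) - f X.

(* The neutral element 1 of the minimum is harmless: for a submodular f with
   f finset.set0 = 0 and positive singletons, each of the quotients is at most 1. *)
Definition curvature E f : R :=
  1 - \big[Num.min/1]_(e in E) (marginal f e (E :\ e) / f [set e]).

(* Positivity on singletons makes the quotients in the curvature meaningful. *)
Definition instance (kappa : R) E f : Prop :=
  [/\ simple_graph E,
      exists X, perfect_matching E X,
      [/\ forall X, X \subset E -> 0 <= f X, f finset.set0 = 0,
          monotone_on E f & submodular_on E f]
    & (forall e, e \in E -> 0 < f [set e]) /\ curvature E f = kappa].

Definition optimal E f Y : Prop :=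
  perfect_matching E Y /\ forall Z, perfect_matching E Z -> f Y <= f Z.

End Problem.

(* The model of computation is a random access machine with a memory of natural
   numbers (unit cost +, truncated -, indirect addressing: polynomially
   equivalent to Turing machines), a memory of real numbers (unit cost field
   operations and comparison), random bits, read access to the adjacency relation
   of the graph, and value-oracle queries. Arguments of type nat are register
   numbers, program positions, or, for c in NConst, a value. *)
Inductive instr (R : Type) : Type :=
| NConst (dst c : nat)
| NAdd (dst a b : nat)
| NSub (dst a b : nat)
| NLoad (dst addr : nat)
| NStore (addr src : nat)
| RConst (dst : nat) (x : R)
| RAdd (dst a b : nat)
| RSub (dst a b : nat)
| RMul (dst a b : nat)
| RDiv (dst a b : nat)
| RLoad (dst addr : nat)
| RStore (addr src : nat)
| JumpZero (a target : nat)
| JumpLe (a b target : nat)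
| RandomBit (dst : nat)
| Adjacent (dst a b : nat)
| Query (dst base : nat)
| Halt (base : nat).

Definition program (R : Type) := seq (instr R).

Record config (R : Type) := Config {
  pc : nat;
  nmem : nat -> nat;
  rmem : nat -> R }.

Definition upd (T : Type) (m : nat -> T) (a : nat) (x : T) : nat -> T :=
  fun k => if k == a then x else m k.

Section Machine.
Variables (R : realType) (n : nat) (E : {set {set 'I_n}}).
Implicit Types (m : nat -> nat) (P : program R) (c : config R)
  (f : {set {set 'I_n}} -> R).

(* Sets of edges are passed from the machine, in queries and as its output, as
   n * n tables stored row by row: the entry in row i and column j sits at offset
   i * n + j. An edge is selected when either of its two entries is nonzero. *)
Definition edges_at m (base : nat) : {set {set 'I_n}} :=
  [set e in E | [exists i : 'I_n, exists j : 'I_n,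
     (e == [set i; j]) && (m (base + (i * n + j)) != 0)%N]].

Definition adjacent (i j : nat) : bool :=
  [exists u : 'I_n, exists v : 'I_n,
     [&& u == i :> nat, v == j :> nat & [set u; v] \in E]].

(* Initially register 0 holds n and all the rest of both memories is zero; the
   graph itself is read by the instruction Adjacent. *)
Definition init_config : config R :=
  Config 0%N (fun k => if k == 0%N then n else 0%N) (fun _ => 0).

(* Running past the end of the program amounts to halting. *)
Definition current P c : instr R := nth (Halt R 0) P (pc c).

Definition step P f (coin : bool) c : config R :=
  let: Config p m r := c in
  match current P c with
  | NConst d k => Config p.+1 (upd m d k) r
  | NAdd d a b => Config p.+1 (upd m d (m a + m b)%N) r
  | NSub d a b => Config p.+1 (upd m d (m a - m b)%N) r
  | NLoad d a => Config p.+1 (upd m d (m (m a))) r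
  | NStore a s => Config p.+1 (upd m (m a) (m s)) r
  | RConst d x => Config p.+1 m (upd r d x)
  | RAdd d a b => Config p.+1 m (upd r d (r a + r b))
  | RSub d a b => Config p.+1 m (upd r d (r a - r b))
  | RMul d a b => Config p.+1 m (upd r d (r a * r b))
  | RDiv d a b => Config p.+1 m (upd r d (r a / r b))
  | RLoad d a => Config p.+1 m (upd r d (r (m a)))
  | RStore a s => Config p.+1 m (upd r (m a) (r s))
  | JumpZero a t => Config (if m a == 0%N then t else p.+1) m r
  | JumpLe a b t => Config (if r a <= r b then t else p.+1) m r
  | RandomBit d => Config p.+1 (upd m d (nat_of_bool coin)) r
  | Adjacent d a b => Config p.+1 (upd m d (nat_of_bool (adjacent (m a) (m b)))) r
  | Query d b => Config p.+1 m (upd r d (f (edges_at m (m b))))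
  | Halt _ => c
  end.

(* The bit coins t is only available at time t, so that distinct executions of
   RandomBit use distinct bits. *)
Fixpoint run P f (coins : nat -> bool) (t : nat) : config R :=
  if t is t'.+1 then step P f (coins t') (run P f coins t') else init_config.

Definition halted P c : bool := if current P c is Halt _ then true else false.

Definition output P c : {set {set 'I_n}} :=
  if current P c is Halt b then edges_at (nmem c) (nmem c b) else finset.set0.

Definition halts_within P f (T : nat) : Prop :=
  forall coins, halted P (run P f coins T).

(* Only the first T random bits matter for the first T steps, so the probability
   space is that of uniformly distributed T-tuples of bits. *)
Definition result P f (T : nat) (w : T.-tuple bool) : {set {set 'I_n}} :=
  output P (run P f (nth false w) T).

Definition expected_cost P f (T : nat) : R :=
  (\sum_(w : T.-tuple bool) f (result P f w)) / 2 ^+ T.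

Definition success_probability P f (T : nat) (bound : R) : R :=
  #|[set w : T.-tuple bool |
      perfect_matching E (result P f w) && (f (result P f w) <= bound)]|%:R / 2 ^+ T.

Definition factor_in_expectation P f (T : nat) (alpha : R) : Prop :=
  (forall w : T.-tuple bool, perfect_matching E (result P f w)) /\
  forall Y, optimal E f Y -> expected_cost P f T <= alpha * f Y.

Definition factor_with_probability (p : R) P f (T : nat) (alpha : R) : Prop :=
  forall Y, optimal E f Y -> p <= success_probability P f T (alpha * f Y).

End Machine.

Definition polynomial_bound (T : nat -> nat) : Prop :=
  exists c d : nat, forall s : nat, (T s <= c * s ^ d + c)%N.

Definition graph_size (n : nat) (E : {set {set 'I_n}}) : nat := (n + #|E|)%N.

(* T is a worst-case bound over all sequences of random bits; nothing is required
   on inputs violating the promises of the problem. *)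
Definition runs_in_time (R : realType) (kappa : R) (P : program R)
    (T : nat -> nat) : Prop :=
  forall (n : nat) (E : {set {set 'I_n}}) (f : {set {set 'I_n}} -> R),
    instance kappa E f -> halts_within E P f (T (graph_size E)).

Definition achieves_in_expectation (R : realType) (kappa : R) (P : program R)
    (T : nat -> nat) (n : nat) (alpha : R) : Prop :=
  forall (E : {set {set 'I_n}}) (f : {set {set 'I_n}} -> R),
    instance kappa E f -> factor_in_expectation E P f (T (graph_size E)) alpha.

Definition achieves_with_probability (R : realType) (kappa p : R) (P : program R)
    (T : nat -> nat) (n : nat) (alpha : R) : Prop :=
  forall (E : {set {set 'I_n}}) (f : {set {set 'I_n}} -> R),
    instance kappa E f -> factor_with_probability E p P f (T (graph_size E)) alpha.

Definition hardness_factor (R : realType) (kappa eps delta : R) (n : nat) : R :=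
  let x := n%:R `^ (1 - 3 * eps) in
  x / (2 + (x - 2) * (1 - kappa) + 2 * delta * kappa).

(* Main.v *)
(* Hide a random perfect matching M in K_{k,k} and charge it only b: with
   g_M(X) = min(k, |X \ M| + min(b, |X & M|)), the cost kappa g_M(X) + (1 - kappa)|X|
   has curvature kappa, and M costs kappa b + (1 - kappa)k while a matching that
   overlaps M in at most b edges costs k. A query X distinguishes g_M from
   g_0(X) = min(k, |X|) only if |X| <= 2k and |X & M| >= b, which for fixed X has
   probability at most C(2k,b)(k-b)!/k! <= 4^b/b! over M. Take the queries that the
   algorithm makes when it is run on g_0, together with its output: averaging over
   M gives one matching that, for all but a few sequences of coins, none of them
   detects, so that the run on M is the same and its output costs k. With k = 2^l
   and b = l^2 the exceptional fraction is superpolynomially small in k, and b is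
   still below n^(3 eps) for n = 2k. *)
Require Import Defs.
From mathcomp Require Import all_boot all_order all_algebra all_fingroup.
From mathcomp Require Import all_classical all_reals all_analysis.
From mathcomp Require Import zify ring lra.
From mathcomp Require Import fintype finset.

Set Implicit Arguments.
Unset Strict Implicit.
Unset Printing Implicit Defensive.

Import Order.TTheory GRing.Theory Num.Theory.
Local Open Scope ring_scope.

(** * Integer-valued monotone submodular set functions *)

Section SetFunctions.
Variable T : finType.
Implicit Types (X Y A : {set T}) (h : {set T} -> nat).

Definition nat_monotone h := forall X Y, X \subset Y -> (h X <= h Y)%N.
Definition nat_submodular h :=
  forall X Y, (h (X :|: Y) + h (X :&: Y) <= h X + h Y)%N.

Lemma minn_monotone c h : nat_monotone h -> nat_monotone (fun X => minn c (h X)).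
Proof. by move=> hm X Y /hm; lia. Qed.

(** If [h X] reaches [c], monotonicity makes the union reach it too, and what remains compares the
    intersection with [Y]. If neither set reaches [c], the truncation only lowers the left side. *)
Lemma minn_submodular c h : nat_monotone h -> nat_submodular h ->
  nat_submodular (fun X => minn c (h X)).
Proof.
move=> hm hs X Y; have := hs X Y.
have := hm _ _ (subsetUl X Y); have := hm _ _ (subsetUr X Y).
have := hm _ _ (subsetIl X Y); have := hm _ _ (subsetIr X Y).
lia.
Qed.

Lemma addn_monotone h1 h2 : nat_monotone h1 -> nat_monotone h2 ->
  nat_monotone (fun X => h1 X + h2 X)%N.
Proof. by move=> m1 m2 X Y XY; rewrite leq_add ?m1 ?m2. Qed.

Lemma addn_submodular h1 h2 : nat_submodular h1 -> nat_submodular h2 ->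
  nat_submodular (fun X => h1 X + h2 X)%N.
Proof. by move=> s1 s2 X Y; have := s1 X Y; have := s2 X Y; lia. Qed.

Lemma cardI_monotone A : nat_monotone (fun X => #|X :&: A|).
Proof. by move=> X Y XY; rewrite subset_leq_card ?setSI. Qed.

Lemma cardI_submodular A : nat_submodular (fun X => #|X :&: A|).
Proof.
by move=> X Y; rewrite setIUl setIIl cardsUI.
Qed.

(** This is the rank function of a matroid: the direct sum of the free matroid off [A] and the
    uniform matroid of rank [b] on [A], truncated to rank [k]. The case of empty [A] hides
    nothing. *)
Definition hidden_rank k b A X := minn k (#|X :&: ~: A| + minn b #|X :&: A|).

Lemma hidden_rank_monotone k b A : nat_monotone (hidden_rank k b A).
Proof.
apply/minn_monotone/addn_monotone; first exact: cardI_monotone.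
exact/minn_monotone/cardI_monotone.
Qed.

Lemma hidden_rank_submodular k b A : nat_submodular (hidden_rank k b A).
Proof.
have mA := @cardI_monotone A; apply: minn_submodular.
  by apply: addn_monotone; [exact: cardI_monotone|exact: minn_monotone].
apply: addn_submodular; first exact: cardI_submodular.
exact/minn_submodular/cardI_submodular.
Qed.

Lemma hidden_rank0 k b X : hidden_rank k b set0 X = minn k #|X|.
Proof. by rewrite /hidden_rank setC0 setIT setI0 cards0 minn0 addn0. Qed.

(** If [X] has fewer than [b] elements in [A], the inner truncation is inactive. If it has more than
    [2k] elements, more than [k] lie off [A], and both ranks are saturated at [k]. *)
Lemma hidden_rank_neq k b A X : (#|A| <= k)%N ->
  hidden_rank k b A X != hidden_rank k b set0 X ->
  (#|X| <= k.*2)%N /\ (b <= #|X :&: A|)%N.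
Proof.
have := cardsID A X; rewrite setDE hidden_rank0 /hidden_rank.
have := subset_leq_card (subsetIr X A); lia.
Qed.

End SetFunctions.

(** * The hidden cost and its curvature *)

Section HiddenCost.
Variables (R : realType) (n : nat) (kappa : R).
Implicit Types (E A X : {set {set 'I_n}}).

Definition hidden_cost k b A X : R :=
  kappa * (hidden_rank k b A X)%:R + (1 - kappa) * #|X|%:R.

(** With more than [k] edges off [A], deleting one edge from [E] leaves the rank saturated at [k].
    The last marginal of every edge is then the linear part [1 - kappa] alone, while singletons cost
    1. *)
Lemma hidden_cost_instance k b E A : 0 < kappa -> kappa <= 1 ->
    (0 < k)%N -> (0 < b)%N ->
    simple_graph E -> (exists X, perfect_matching E X) ->
    (k < #|E :&: ~: A|)%N ->
  instance kappa E (hidden_cost k b A).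
Proof.
move=> k0 k1 kgt0 bgt0 simpleE pmE kE.
have k1' : 0 <= 1 - kappa by lra.
have singleton e : hidden_cost k b A [set e] = 1.
  rewrite /hidden_cost cards1 (_ : hidden_rank _ _ _ _ = 1%N); first by lra.
  have := cardsID A [set e]; rewrite setDE cards1 /hidden_rank.
  have := subset_leq_card (subsetIl [set e] A); rewrite cards1; lia.
have quotient e : e \in E ->
    marginal (hidden_cost k b A) e (E :\ e) / hidden_cost k b A [set e]
    = 1 - kappa.
  move=> eE; rewrite singleton divr1 /marginal setD1K // /hidden_cost.
  have -> : hidden_rank k b A E = k by rewrite /hidden_rank; lia.
  have -> : hidden_rank k b A (E :\ e) = k.
    rewrite /hidden_rank; have := cardsD1 e (E :&: ~: A).
    by rewrite -setIDAC; lia.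
  by rewrite (cardsD1 e E) eE add1n -natr1; ring.
split=> //.
- split.
  + by move=> X _; rewrite addr_ge0 ?mulr_ge0 ?ler0n ?(ltW k0).
  + by rewrite /hidden_cost /hidden_rank !set0I cards0 !minn0 !mulr0 addr0.
  + move=> X Y XY _; rewrite lerD // ler_wpM2l ?(ltW k0) // ler_nat.
      exact: hidden_rank_monotone.
    exact: subset_leq_card.
  + move=> X Y _ _; rewrite /hidden_cost.
    have /(congr1 (fun m => m%:R : R)) := cardsUI X Y.
    have := @hidden_rank_submodular _ k b A X Y; rewrite -(ler_nat R).
    rewrite !natrD => h1 h2; have := ler_wpM2l (ltW k0) h1; nra.
- split=> [e _|]; first by rewrite singleton ltr01.
  (* On an empty edge set the default 1 of the minimum would give curvature 0. *)
  have [e0 e0E] : exists e, e \in E.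
    apply/set0Pn; apply: contraTneq kE => ->; rewrite set0I cards0; lia.
  rewrite /curvature (eq_bigr _ quotient).
  suff -> : \big[Order.min/1]_(e in E) (1 - kappa) = 1 - kappa by lra.
  apply/le_anti/andP; split; last by apply: le_bigmin => //; lra.
  exact: (bigmin_le_cond _ (fun _ => 1 - kappa) e0E).
Qed.

End HiddenCost.

(** * Runs that cannot tell two oracles apart *)

Section Execution.
Variables (R : realType) (n : nat) (E : {set {set 'I_n}}) (P : program R).
Implicit Types (f g : {set {set 'I_n}} -> R).

(** Away from a [Query] the oracle is not consulted; the default is the empty set, where all hidden
    costs vanish. *)
Definition queried (c : config R) : {set {set 'I_n}} :=
  if current P c is Query _ b then edges_at E (nmem c) (nmem c b) else set0.

Lemma step_eq f g coin c : f (queried c) = g (queried c) ->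
  step E P f coin c = step E P g coin c.
Proof.
case: c => p m r; rewrite /queried /step.
by case: current => //= d b ->.
Qed.

(* The final output is counted as a last query, so that agreement on all probed
   sets also fixes the cost of the output. *)
Definition probed f T (w : T.-tuple bool) (t : 'I_T.+1) : {set {set 'I_n}} :=
  if (t < T)%N then queried (run E P f (nth false w) t) else result E P f w.

(** Only the sets probed in the run on [f] matter, even though queries are adaptive: as long as the
    two runs coincide, the next query of the run on [g] is that of the run on [f]. *)
Lemma result_eq f g T (w : T.-tuple bool) :
  (forall t, g (probed f w t) = f (probed f w t)) ->
  result E P g w = result E P f w /\ g (result E P f w) = f (result E P f w).
Proof.
move=> gf; split; last by have := gf ord_max; rewrite /probed /= ltnn.
rewrite /result; congr output.
suff: forall t, (t <= T)%N ->
  run E P g (nth false w) t = run E P f (nth false w) t by apply.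
elim=> //= t IH tT; rewrite IH; last exact: ltnW.
by apply: step_eq; have := gf (Ordinal (leqW tT : (t < T.+1)%N)); rewrite /probed /= tT.
Qed.

End Execution.

(** * Counting inequalities *)

Lemma average_le (I W : finType) (B : I -> W -> bool) (c M : nat) :
    (forall w, #|[set i | B i w]| * c <= M * #|I|)%N -> (0 < #|I|)%N ->
  exists i, (#|[set w | B i w]| * c <= M * #|W|)%N.
Proof.
move=> BM I0; apply/existsP; rewrite -[X in is_true X]negbK.
apply/negP => /existsPn noi.
(* The pairs in [B] are counted by [i] and by [w]; under [noi] the first count would exceed the
   bound on the second. *)
have sumE : (\sum_i #|[set w | B i w]| = \sum_w #|[set i | B i w]|)%N.
  under eq_bigr do rewrite -sum1_card big_mkcond /=.
  rewrite exchange_big /=; apply: eq_bigr => w _.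
  rewrite -sum1_card [RHS]big_mkcond /=; apply: eq_bigr => i _.
  by rewrite !inE.
have : (\sum_(i : I) (M * #|W|).+1 <= \sum_i #|[set w | B i w]| * c)%N.
  by apply: leq_sum => i _; rewrite ltnNge noi.
have : (\sum_w #|[set i | B i w]| * c <= \sum_(w : W) M * #|I|)%N.
  by apply: leq_sum => w _.
rewrite !sum_nat_const -!big_distrl /= sumE => ub /leq_trans/(_ ub).
by rewrite mulnCA mulnA (mulnC (M * _)%N) leq_pmul2l // mulnC ltnn.
Qed.

Lemma card_exists_le (I J : finType) (C : I -> J -> bool) :
  (#|[set i | [exists j, C i j]]| <= \sum_j #|[set i | C i j]|)%N.
Proof.
apply: (@leq_trans #|\bigcup_j [set i | C i j]|).
  apply: subset_leq_card; apply/subsetP => i; rewrite inE => /existsP[j Cij].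
  by apply/bigcupP; exists j; rewrite ?inE.
elim/big_rec2: _ => [|j m U _ IH]; first by rewrite cards0.
by apply: leq_trans (leq_card_setU _ _) _; rewrite leq_add2l.
Qed.

(** Up to [b = a] the factor [a ^ a] suffices alone; beyond it, each step multiplies the left side
    by [a] and the factorial by more than [a]. *)
Lemma expn_le_fact a b : (a ^ b <= a ^ a * b`!)%N.
Proof.
case: a => [|a]; first by case: b => // b; rewrite exp0n.
elim: b => [|b IH]; first by rewrite expn0 muln1 expn_gt0.
have [ab|ba] := leqP b.+1 a.+1.
  by rewrite (leq_trans (leq_pexp2l _ ab)) // leq_pmulr // fact_gt0 //.
by rewrite expnS factS mulnCA leq_mul // ltnW //.
Qed.

Lemma ffact_le_expn m b : (m ^_ b <= m ^ b)%N.
Proof.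
by elim: b => // b IH; rewrite ffactnSr expnSr leq_mul ?leq_subr.
Qed.

Lemma expn_le_ffact m b : ((m - b) ^ b <= m ^_ b)%N.
Proof.
elim: b => // b IH; rewrite ffactnSr expnSr leq_mul ?leq_sub2l //.
by apply: leq_trans IH; case: (b) => // b'; rewrite leq_exp2r // leq_sub2l.
Qed.

(** * Perfect matchings of the complete bipartite graph as permutations *)

Section CompleteBipartiteGraph.
Variable k : nat.
Implicit Types (i j : 'I_k) (s : 'S_k).

Definition bedge i j : {set 'I_(k + k)} := [set lshift k i; rshift k j].

Lemma bedge_inj i j i' j' : bedge i j = bedge i' j' -> i = i' /\ j = j'.
Proof.
move=> /setP ij; split.
  have := ij (lshift k i); rewrite !inE eqxx eq_lshift !eq_lrshift !orbF.
  by move=> /esym/eqP.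
have := ij (rshift k j); rewrite !inE eqxx orbT eq_rshift !eq_rlshift /=.
by move=> /esym/eqP.
Qed.

Definition complete_bipartite : {set {set 'I_(k + k)}} :=
  [set bedge p.1 p.2 | p : 'I_k * 'I_k].

Definition perm_matching s : {set {set 'I_(k + k)}} :=
  [set bedge i (s i) | i : 'I_k].

Lemma mem_perm_matching s i j : (bedge i j \in perm_matching s) = (j == s i).
Proof.
apply/imsetP/eqP => [[i' _ /bedge_inj[-> ->]]//|->]; by exists i.
Qed.

Lemma complete_bipartite_simple : simple_graph complete_bipartite.
Proof.
by move=> _ /imsetP[[i j] _ ->]; rewrite cards2 eq_lrshift.
Qed.

Lemma card_complete_bipartite : #|complete_bipartite| = (k * k)%N.
Proof.
rewrite card_imset ?card_prod ?card_ord // => -[i j] [i' j'] /=.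
by move=> /bedge_inj[-> ->].
Qed.

Lemma card_perm_matching s : #|perm_matching s| = k.
Proof. by rewrite card_imset ?card_ord // => i i' /bedge_inj[]. Qed.

Lemma perm_matching_perfect s :
  perfect_matching complete_bipartite (perm_matching s).
Proof.
apply/andP; split.
  by apply/subsetP => _ /imsetP[i _ ->]; apply/imsetP; exists (i, s i).
apply/forallP => v; rewrite -(splitK v); case: (split v) => i /=.
  apply/cards1P; exists (bedge i (s i)); apply/setP => e; rewrite !inE.
  apply/andP/eqP => [[/imsetP[j _ ->]]|->].
    by rewrite !inE eq_lshift eq_lrshift orbF => /eqP ->.
  by rewrite !inE eqxx mem_perm_matching.
apply/cards1P; exists (bedge ((s^-1)%g i) i); apply/setP => e; rewrite !inE.
apply/andP/eqP => [[/imsetP[j _ ->]]|->].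
  by rewrite !inE eq_rshift eq_rlshift /= => /eqP ->; rewrite permK.
by rewrite !inE eqxx orbT mem_perm_matching permKV.
Qed.

(** Double counting of incidences: each of the [2k] vertices lies on one edge of [X], and each edge
    has two ends. *)
Lemma card_perfect_matching X : perfect_matching complete_bipartite X -> #|X| = k.
Proof.
move=> /andP[XE /forallP pm].
have : (\sum_(v : 'I_(k + k)) #|[set e in X | v \in e]| = \sum_(e in X) #|e|)%N.
  rewrite (eq_bigr (fun v => \sum_(e in X) (v \in e))%N) => [|v _].
    rewrite exchange_big /=; apply: eq_bigr => e _.
    by rewrite -sum1_card [RHS]big_mkcond.
  rewrite -sum1_card big_mkcond [RHS]big_mkcond; apply: eq_bigr => e _.
  by rewrite inE; case: (e \in X).
have -> : (\sum_(v : 'I_(k + k)) #|[set e in X | v \in e]| = k + k)%N.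
  rewrite (eq_bigr (fun=> 1%N)) => [|v _]; last exact/eqP/pm.
  by rewrite sum_nat_const card_ord muln1.
have -> : (\sum_(e in X) #|e| = #|X| * 2)%N.
  rewrite -sum_nat_const; apply: eq_bigr => e eX.
  exact: complete_bipartite_simple (subsetP XE e eX).
by lia.
Qed.

(** The edges of [Q] prescribe the permutation at [#|Q|] points, which leaves the other [k - #|Q|]
    values to be permuted. *)
Lemma card_matchings_containing (Q : {set {set 'I_(k + k)}}) :
  (#|[set s | Q \subset perm_matching s]| <= (k - #|Q|)`!)%N.
Proof.
have [s0|none] := pickP (fun s => Q \subset perm_matching s); last first.
  rewrite (_ : [set s | _] = set0) ?cards0 //.
  by apply/setP => s; rewrite !inE none.
move=> Qs0; pose B := [set i | bedge i (s0 i) \in Q].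
have cardB : #|B| = #|Q|.
  have /card_imset <- : injective (fun i => bedge i (s0 i)).
    by move=> i i' /bedge_inj[].
  apply: eq_card => e; apply/imsetP/idP => [[i]|eQ]; first by rewrite inE => ? ->.
  have /imsetP[i _ ei] := subsetP Qs0 e eQ.
  by exists i; rewrite // inE -ei.
have -> : (k - #|Q|)`! = #|perm_on (~: B)|.
  by rewrite card_perm -cardB -{1}(card_ord k) -(cardsC B) addKn.
(* The matchings containing Q form a coset of the permutations fixing B. *)
rewrite -(card_imset _ (mulIg (s0^-1)%g)); apply: subset_leq_card.
apply/subsetP => _ /imsetP[s + ->]; rewrite inE => /subsetP Qs.
apply/subsetP => i; apply: contraNT; rewrite !inE negbK => /Qs.
by rewrite mem_perm_matching permM => /eqP <-; rewrite permK.
Qed.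

(* Union bound over the b-subsets Q of X; the constant comes from
   4^b / b! <= 8^8 / 2^b. *)
Lemma card_overlapping_perms b (X : {set {set 'I_(k + k)}}) :
    (b.*2 <= k)%N -> (#|X| <= k.*2)%N ->
  (#|[set s | (b <= #|X :&: perm_matching s|)%N]| * 2 ^ b <= 8 ^ 8 * k`!)%N.
Proof.
move=> bk Xk.
have count : (#|[set s | (b <= #|X :&: perm_matching s|)%N]|
              <= 'C(#|X|, b) * (k - b)`!)%N.
  rewrite -cards_draws.
  apply: (@leq_trans (\sum_(Q in [set Q : {set _} | Q \subset X & #|Q| == b])
                       #|[set s | Q \subset perm_matching s]|)%N); last first.
    rewrite -sum_nat_const; apply: leq_sum => Q; rewrite inE => /andP[_ /eqP <-].
    exact: card_matchings_containing.
  apply: (@leq_trans #|\bigcup_(Q in [set Q : {set _} | Q \subset X & #|Q| == b])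
                       [set s | Q \subset perm_matching s]|).
    apply: subset_leq_card; apply/subsetP => s; rewrite inE => bs.
    have : (0 < #|[set Q : {set _} | Q \subset X :&: perm_matching s & #|Q| == b]|)%N.
      by rewrite cards_draws bin_gt0.
    case/card_gt0P => Q; rewrite inE subsetI => /andP[/andP[QX Qs] Qb].
    by apply/bigcupP; exists Q; rewrite inE ?QX.
  elim/big_rec2: _ => [|Q m U _ IH]; first by rewrite cards0.
  by apply: leq_trans (leq_card_setU _ _) _; rewrite leq_add2l.
(* From [2b <= k] follows [2k <= 4(k - b)], so each factor of the falling factorial of [#|X|] is at
   most [4(k - b)]. *)
have bin_le : ('C(#|X|, b) * b`! <= 4 ^ b * k ^_ b)%N.
  rewrite bin_ffact (leq_trans (ffact_le_expn _ _)) //.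
  apply: (@leq_trans ((4 * (k - b)) ^ b)); last first.
    by rewrite expnMn leq_mul // expn_le_ffact.
  by case: (b) bk => // b' bk; rewrite leq_exp2r //; lia.
have kE : (k ^_ b * (k - b)`! = k`!)%N by apply: ffact_fact; lia.
(* After this multiplication the powers combine to [8 ^ b], which [expn_le_fact] with [a = 8]
   bounds. *)
rewrite -(@leq_pmul2r (4 ^ b * b`!)) ?muln_gt0 ?expn_gt0 ?fact_gt0 //.
apply: (@leq_trans ('C(#|X|, b) * (k - b)`! * 2 ^ b * (4 ^ b * b`!))).
  by rewrite leq_mul // leq_mul.
rewrite [leqLHS](_ : _ = 'C(#|X|, b) * b`! * (k - b)`! * (2 * 4) ^ b)%N; last first.
  by rewrite expnMn; ring.
apply: (@leq_trans (4 ^ b * k ^_ b * (k - b)`! * 8 ^ b)).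
  by rewrite leq_mul // leq_mul.
rewrite -[X in (X * _)%N]mulnA kE.
apply: (@leq_trans (4 ^ b * k`! * (8 ^ 8 * b`!))); last by apply/eq_leq; ring.
by rewrite leq_mul // expn_le_fact.
Qed.

End CompleteBipartiteGraph.

(** * Few coin sequences find a matching cheaper than k *)

Section CheapOutputs.
Variables (R : realType) (kappa : R) (k b : nat).
Local Notation E := (complete_bipartite k).
Local Notation cost s := (@hidden_cost R _ kappa k b (@perm_matching k s)).

Lemma hidden_cost_perm_matching s : (b <= k)%N ->
  cost s (perm_matching s) = kappa * b%:R + (1 - kappa) * k%:R.
Proof.
move=> bk; rewrite /hidden_cost /hidden_rank setICr setIid cards0 card_perm_matching.
by congr (_ * _%:R + _); lia.
Qed.

Lemma perm_matching_cost_instance s : 0 < kappa -> kappa <= 1 ->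
  (0 < b)%N -> (2 < k)%N -> instance kappa E (cost s).
Proof.
move=> k0 k1 b0 k2; apply: hidden_cost_instance => //; first exact: ltnW (ltnW k2).
- exact: complete_bipartite_simple.
- by exists (perm_matching s); apply: perm_matching_perfect.
(* The graph has [k * k] edges, and [k * k - k > k] because [2 < k]. *)
- rewrite -setDE cardsD (setIidPr _) ?card_perm_matching ?card_complete_bipartite.
    nia.
  by have /andP[] := perm_matching_perfect s.
Qed.

(** The threshold [k] is the cost of every perfect matching when nothing is hidden, so these are the
    coins for which the run profits from the hidden matching. *)
Definition cheap_outputs (P : program R) T s : {set T.-tuple bool} :=
  [set w | perfect_matching E (result E P (cost s) w)
           && (cost s (result E P (cost s) w) < k%:R)].

(** For fixed coins the sets probed in the run on [f0] do not depend on [s], so a union bound over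
    the [T.+1] of them applies before averaging over the coins. *)
Lemma card_cheap_outputs (P : program R) T : (b.*2 <= k)%N ->
  exists s, (#|cheap_outputs P T s| * 2 ^ b <= T.+1 * 8 ^ 8 * 2 ^ T)%N.
Proof.
move=> bk; pose f0 : _ -> R := @hidden_cost R (k + k) kappa k b set0.
pose rank s := hidden_rank k b (@perm_matching k s).
pose bad (s : 'S_k) (w : T.-tuple bool) := [exists t,
  rank s (probed E P f0 w t) != hidden_rank k b set0 (probed E P f0 w t)].
have card_bad w : (#|[set s | bad s w]| * 2 ^ b <= T.+1 * 8 ^ 8 * #|{: 'S_k}|)%N.
  apply: leq_trans (leq_mul (card_exists_le _) (leqnn _)) _.
  rewrite big_distrl -mulnA -[X in (_ <= X * _)%N]card_ord -sum_nat_const.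
  apply: leq_sum => t _; set X := probed _ _ _ _ _; rewrite card_Sn.
  (* Small sets are handled by the overlap count; larger ones never reveal anything. *)
  have [Xk|Xk] := leqP #|X| k.*2.
    apply: leq_trans (card_overlapping_perms bk Xk); rewrite leq_mul //.
    apply: subset_leq_card; apply/subsetP => s; rewrite !inE.
    by move/hidden_rank_neq; rewrite card_perm_matching => /(_ (leqnn _))[].
  rewrite (_ : [set s | _] = set0) ?cards0 //; apply/setP => s; rewrite !inE.
  apply/negbTE/negP => /hidden_rank_neq; rewrite card_perm_matching.
  by move=> /(_ (leqnn _))[]; rewrite leqNgt Xk.
have [|s cheap] := average_le card_bad; first by rewrite card_Sn fact_gt0.
exists s; rewrite card_tuple card_bool in cheap; apply: leq_trans cheap.
rewrite leq_mul //; apply: subset_leq_card; apply/subsetP => w.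
rewrite !inE; apply: contraLR => /existsPn good.
have agree t : cost s (probed E P f0 w t) = f0 (probed E P f0 w t).
  by have := good t; rewrite negbK /rank => /eqP rankE; rewrite /f0 /hidden_cost rankE.
have [-> ->] := result_eq agree.
apply/negP => /andP[/card_perfect_matching Xk].
rewrite /f0 /hidden_cost hidden_rank0 Xk minnn -mulrDl.
by rewrite addrC subrK mul1r ltxx.
Qed.

End CheapOutputs.

(** * Asymptotic estimates for k = 2^l and b = l^2 *)

Section Asymptotics.
Variable R : realType.
Implicit Types (kappa eps delta : R).

(** With [z = n ^ (3 eps)] one has [x z = n = 2k]; multiplying numerator and denominator of the
    hardness factor by [z / 2] turns it into the right side with [(1 + delta) z] in place of [y]. *)
Lemma hardness_factor_bound kappa eps delta (k : nat) (y : R) :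
    0 < kappa -> kappa <= 1 -> (0 < k)%N -> 0 < y ->
    y <= (1 + delta) * (k + k)%:R `^ (3 * eps) ->
  hardness_factor kappa eps delta (k + k) <= k%:R / (kappa * y + (1 - kappa) * k%:R).
Proof.
move=> k0 k1 kgt0 y0 yle; rewrite /hardness_factor /=.
set x := _ `^ _; set z := _ `^ _ in yle.
have kR : (0 : R) < k%:R by rewrite ltr0n.
have nR : (0 : R) < (k + k)%:R by rewrite ltr0n addn_gt0 kgt0.
have x0 : 0 < x by exact: powR_gt0.
have z0 : 0 < z by exact: powR_gt0.
have xz : x * z = 2 * k%:R.
  rewrite -powRD; last by rewrite (gt_eqF nR) /= implybT.
  by rewrite subrK powRr1 ?ltW // natrD; ring.
have K1 : 0 <= (1 - kappa) * k%:R by rewrite mulr_ge0 ?subr_ge0.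
have D0 : 0 < kappa * y + (1 - kappa) * k%:R by rewrite ltr_wpDr // mulr_gt0.
have -> : 2 + (x - 2) * (1 - kappa) + 2 * delta * kappa =
    2 * kappa * (1 + delta) + (1 - kappa) * x by ring.
have dz : 0 < (1 + delta) * z by exact: lt_le_trans yle.
have d0 : 0 < 1 + delta by rewrite -(pmulr_lgt0 _ z0).
have X1 : 0 <= (1 - kappa) * x by rewrite mulr_ge0 ?subr_ge0 ?(ltW x0).
have D1 : 0 < 2 * kappa * (1 + delta) + (1 - kappa) * x.
  by rewrite ltr_wpDr // !mulr_gt0.
rewrite ler_pdivrMr // mulrAC ler_pdivlMr //.
rewrite [leRHS](_ : _ = x * (kappa * ((1 + delta) * z) + (1 - kappa) * k%:R)).
  by rewrite ler_pM2l // lerD2r ler_pM2l.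
transitivity (2 * k%:R * (kappa * (1 + delta)) + x * (1 - kappa) * k%:R).
  by ring.
by rewrite -xz; ring.
Qed.

Lemma sqr_le_exp2 l : (7 <= l)%N -> ((l ^ 2).*2 <= 2 ^ l)%N.
Proof.
move=> /subnK <-; elim: (l - 7)%N => // m IH.
by rewrite addSn expnS; move: IH; rewrite -!mul2n !expnS !expn0; nia.
Qed.

(** With [g = eps ln 2] the power is the cube of [exp (g (l + 1))], hence at least
    [(g (l + 1)) ^ 3]. Once [l] exceeds [g ^ -3], this is at least [(l + 1) ^ 2]. *)
Lemma sqr_le_powR eps delta : 0 < eps -> 0 < delta ->
  exists L, forall l, (L <= l)%N ->
  (l ^ 2).+1%:R <= (1 + delta) * (2 ^ l + 2 ^ l)%:R `^ (3 * eps).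
Proof.
move=> eps0 delta0; pose g := eps * ln (2 : R).
have g0 : 0 < g by rewrite mulr_gt0 // ln_gt0 // ltr1n.
exists (Num.bound (g ^- 3)) => l Ll.
have -> : (2 ^ l + 2 ^ l)%:R `^ (3 * eps) = expR (g * l.+1%:R) ^+ 3 :> R.
  rewrite addnn -mul2n -expnS /powR gt_eqF ?ltr0n ?expn_gt0 //.
  rewrite -expRM_natl natrX lnXn ?ltr0n // /g mulr_natr; congr expR; ring.
have gl : 1 <= g ^+ 3 * l.+1%:R.
  rewrite mulrC -ler_pdivrMr ?exprn_gt0 // div1r ltW //.
  apply: lt_le_trans (archi_boundP _) _; first by rewrite invr_ge0 exprn_ge0 ?ltW.
  by rewrite ler_nat leqW.
have le1 : g * l.+1%:R <= expR (g * l.+1%:R).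
  by apply: le_trans (expR_ge1Dx _); rewrite lerDr.
have gl0 : 0 <= g * l.+1%:R by rewrite mulr_ge0 // ltW.
apply: (@le_trans _ _ ((g * l.+1%:R) ^+ 3)).
  apply: (@le_trans _ _ (l.+1%:R ^+ 2)); first by rewrite -natrX ler_nat; nia.
  have -> : (g * l.+1%:R) ^+ 3 = (g ^+ 3 * l.+1%:R) * l.+1%:R ^+ 2 by ring.
  by rewrite ler_peMl ?exprn_ge0.
apply: le_trans (_ : expR (g * l.+1%:R) ^+ 3 <= _).
  by rewrite lerXn2r ?nnegrE ?expR_ge0.
by rewrite ler_peMl ?exprn_ge0 ?expR_ge0 // lerDl ltW.
Qed.

(** The left side is at most a power of two with exponent linear in [l], against [l ^ 2] on the
    right. The factor [2 ^ l] is [k], the loss in cost that one exceptional coin sequence can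
    cause. *)
Lemma superpolynomial_parameter (T : nat -> nat) (eta : R) :
    polynomial_bound T -> 0 < eta ->
  exists L, forall l, (L <= l)%N ->
  ((T (graph_size (complete_bipartite (2 ^ l)))).+1 * 8 ^ 8 * 2 ^ l)%:R
    <= eta * 2 ^+ (l ^ 2).
Proof.
move=> [c [d Tle]] eta0; pose A := (c + Num.bound eta^-1)%N.
(* [2 ^ A] absorbs both [c] and the inverse of [eta]; the threshold makes [l ^ 2] exceed the sum of
   all exponents below, where [3 * 8] stands for [8 ^ 8]. *)
exists (2 * A + 4 * d + 30)%N => l Ll.
have cA : (c <= 2 ^ A)%N.
  by rewrite (leq_trans (ltnW (ltn_expl c (ltnSn 1)))) // leq_pexp2l // leq_addr.
have etaA : 1 <= eta * 2 ^+ A.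
  rewrite mulrC -ler_pdivrMr // div1r ltW //.
  apply: lt_le_trans (archi_boundP _) _; first by rewrite invr_ge0 ltW.
  rewrite -natrX ler_nat (leq_trans (ltnW (ltn_expl _ (ltnSn 1)))) // leq_pexp2l //.
  exact: leq_addl.
have sizeE : (graph_size (complete_bipartite (2 ^ l)) <= 2 ^ (l * 2 + 2))%N.
  rewrite /graph_size card_complete_bipartite expnD expnM.
  have := expn_gt0 2 l; nia.
have TS : ((T (graph_size (complete_bipartite (2 ^ l)))).+1
           <= 2 ^ (A + 2 + (l * 2 + 2) * d))%N.
  apply: leq_ltn_trans (Tle _) _.
  have sd : (graph_size (complete_bipartite (2 ^ l)) ^ d <= 2 ^ ((l * 2 + 2) * d))%N.
    by rewrite expnM; case: (d) => // d'; rewrite leq_exp2r.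
  rewrite 2!expnD; have := expn_gt0 2 ((l * 2 + 2) * d); have := expn_gt0 2 A.
  move: (2 ^ A)%N (2 ^ _)%N (_ ^ d)%N cA sd => a u v cA sd /= a0 u0.
  nia.
have : (A + 2 + (l * 2 + 2) * d + 3 * 8 + l + A <= l ^ 2)%N by nia.
rewrite -(@leq_exp2l 2) // -(ler_nat R) => big.
apply: (@le_trans _ _ (2 ^ (A + 2 + (l * 2 + 2) * d + 3 * 8 + l))%:R).
  have -> : (8 ^ 8 = 2 ^ (3 * 8))%N by rewrite expnM.
  by rewrite ler_nat 2!expnD (leq_mul (leq_mul TS (leqnn _)) (leqnn _)).
move: big; rewrite expnD natrM !natrX => big.
apply: (@le_trans _ _ (eta * (2 ^+ (A + 2 + (l * 2 + 2) * d + 3 * 8 + l) * 2 ^+ A))).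
  by rewrite mulrCA ler_peMr ?exprn_ge0.
by rewrite ler_pM2l.
Qed.

End Asymptotics.

(** * One instance that defeats a given program *)

Lemma hard_instance (R : realType) (kappa eps delta eta : R) (P : program R)
    (T : nat -> nat) (alpha : nat -> R) (N : nat) :
    0 < kappa -> kappa <= 1 -> 0 < eps -> 0 < delta -> 0 < eta ->
    polynomial_bound T ->
    (forall n, (N <= n)%N -> alpha n < hardness_factor kappa eps delta n) ->
  exists k b s, let E := complete_bipartite k in
    let f := @hidden_cost R _ kappa k b (perm_matching s) in
    let t := T (graph_size E) in
    [/\ (0 < k)%N, (N <= k + k)%N, instance kappa E f,
        k%:R * #|cheap_outputs kappa b P t s|%:R <= eta * 2 ^+ t &
        exists2 Y, optimal E f Y & alpha (k + k)%N * f Y <= k%:R - kappa].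
Proof.
move=> k0 k1 eps0 delta0 eta0 Tpoly alphaN.
have [L1 bL1] := sqr_le_powR eps0 delta0.
have [L2 bL2] := superpolynomial_parameter Tpoly eta0.
(* The summand 7 is the threshold of [sqr_le_exp2], which gives [2b <= k]. *)
pose l := (L1 + L2 + N + 7)%N; pose k := (2 ^ l)%N; pose b := (l ^ 2)%N.
have lk : (l < k)%N by exact: ltn_expl.
have bk : (b.*2 <= k)%N by apply: sqr_le_exp2; lia.
have b0 : (0 < b)%N by rewrite expn_gt0; apply/orP; left; lia.
(* The time bound depends on the graph alone, so it is fixed before [s] is chosen. *)
have [s cheap] :=
  card_cheap_outputs kappa P (T (graph_size (complete_bipartite k))) bk.
have kgt0 : (0 < k)%N by lia.
have Nk : (N <= k + k)%N by lia.
have L2l : (L2 <= l)%N by lia.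
(* Using [b + 1] instead of [b] adds [kappa] to the denominator; this yields the gap between
   [k - kappa] and [k]. *)
have yle : b.+1%:R <= (1 + delta) * (k + k)%:R `^ (3 * eps) by apply: bL1; lia.
exists k, b, s => E f t.
have fE : instance kappa E f by apply: perm_matching_cost_instance => //; lia.
have kR : (0 : R) < k%:R by rewrite ltr0n; lia.
split=> //.
- have := bL2 l; rewrite -/k -/b -/E -/t => /(_ L2l) small.
  have b2 : (0 : R) < 2 ^+ b by rewrite exprn_gt0.
  rewrite -(ler_pM2r b2) -mulrA.
  rewrite -(ler_nat R) [X in X <= _]natrM [X in _ <= X]natrM in cheap.
  rewrite (natrX _ 2 b) (natrX _ 2 (T _)) in cheap.
  apply: le_trans (ler_wpM2l (ltW kR) cheap) _.
  rewrite mulrA (mulrC k%:R) (mulrAC eta) ler_wpM2r ?exprn_ge0 //.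
  by rewrite natrM in small.
(* The optimum need not be the hidden matching; it only costs no more. *)
- have [Y pmY Ymin] : exists2 Y, perfect_matching E Y &
      forall Z, perfect_matching E Z -> f Y <= f Z.
    by case: (arg_minP f (perm_matching_perfect s)) => Y pmY Ymin; exists Y.
  exists Y => //.
  have [_ _ [f_ge0 _ _ _] _] := fE.
  have fY0 : 0 <= f Y by apply: f_ge0; case/andP: pmY.
  have bkR : (b.+1)%:R <= k%:R :> R by rewrite ler_nat; lia.
  have K1 : 0 <= (1 - kappa) * k%:R by rewrite mulr_ge0 ?subr_ge0.
  have kb : 0 <= kappa * b%:R by rewrite mulr_ge0 // ltW.
  have fYle : f Y <= kappa * b%:R + (1 - kappa) * k%:R.
    by rewrite -(hidden_cost_perm_matching kappa s) ?Ymin ?perm_matching_perfect //; lia.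
  set D := kappa * b%:R + _ in fYle.
  have D0 : 0 <= D by exact: addr_ge0.
  have DE : kappa * (b.+1)%:R + (1 - kappa) * k%:R = D + kappa.
    by rewrite /D -natr1; ring.
  have Dk : D + kappa <= k%:R by rewrite -DE; have := ler_wpM2l (ltW k0) bkR; lra.
  have := alphaN (k + k)%N Nk.
  have := hardness_factor_bound k0 k1 kgt0 (ltr0Sn _ _) yle.
  rewrite DE => hle alt; have {hle}alt := lt_le_trans alt hle.
  have D1 : 0 < D + kappa by rewrite ltr_wpDl.
  move: alt; rewrite ltr_pdivlMr //; move: (alpha _) => a alt.
  (* The sign of [alpha] is unknown; a negative factor makes the product nonpositive. *)
  have [a0|a0] := leP 0 a; last first.
    apply: (@le_trans _ _ 0); last by rewrite subr_ge0 (le_trans k1) // ler1n.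
    by rewrite mulr_le0_ge0 // ltW.
  apply: (le_trans (ler_wpM2l a0 fYle)).
  (* [k - k D / (D + kappa)] is at least [kappa], because [D + kappa <= k]. *)
  rewrite -(ler_pM2r D1).
  have : a * D * (D + kappa) <= k%:R * D by rewrite mulrAC ler_wpM2r // ltW.
  have := ler_wpM2l (ltW k0) Dk; clearbody D; clear; lra.
Qed.

(** * Refuting the two kinds of guarantee *)

Lemma expected_cost_ge (R : realType) (kappa : R) (k b : nat) (s : 'S_k)
    (P : program R) (T : nat) :
    let E := complete_bipartite k in
    let f := hidden_cost kappa k b (perm_matching s) in
    instance kappa E f ->
    (forall w : T.-tuple bool, perfect_matching E (result E P f w)) ->
  k%:R * 2 ^+ T - k%:R * #|cheap_outputs kappa b P T s|%:R
    <= expected_cost E P f T * 2 ^+ T.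
Proof.
move=> E f [_ _ [f_ge0 _ _ _] _] pm.
rewrite /expected_cost divfK ?expf_neq0 ?pnatr_eq0 //.
have <- : (\sum_(w : T.-tuple bool) k%:R) = k%:R * 2 ^+ T :> R.
  by rewrite sumr_const card_tuple card_bool -natrX mulr_natr.
have <- : (\sum_(w in cheap_outputs kappa b P T s) k%:R)
    = k%:R * #|cheap_outputs kappa b P T s|%:R :> R.
  by rewrite sumr_const mulr_natr.
(* Termwise: an output that is not cheap costs at least [k], and a cheap one at least 0. *)
rewrite [X in _ - X]big_mkcond -sumrB; apply: ler_sum => w _.
rewrite inE pm /= -/f -/E; case: ltP => [_|]; last by rewrite subr0.
by rewrite subrr f_ge0 //; case/andP: (pm w).
Qed.

Lemma success_probability_le (R : realType) (kappa bound : R) (k b : nat)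
    (s : 'S_k) (P : program R) (T : nat) :
    let E := complete_bipartite k in
    let f := hidden_cost kappa k b (perm_matching s) in
    bound < k%:R ->
  success_probability E P f T bound <= #|cheap_outputs kappa b P T s|%:R / 2 ^+ T.
Proof.
move=> E f lt_bound; rewrite ler_wpM2r ?invr_ge0 ?exprn_ge0 // ler_nat.
apply: subset_leq_card; apply/subsetP => w; rewrite !inE => /andP[-> /=].
by move/le_lt_trans; apply.
Qed.

Local Open Scope classical_set_scope.
Local Open Scope ring_scope.

Theorem theorem8 (R : realType) (kappa eps delta : R)
    (kappa_gt0 : 0 < kappa) (kappa_le1 : kappa <= 1)
    (eps_gt0 : 0 < eps) (delta_gt0 : 0 < delta) :
  (~ exists (P : program R) (T : nat -> nat) (alpha : nat -> R),
      [/\ polynomial_bound T, runs_in_time kappa P T &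
          \forall n \near \oo,
            alpha n < hardness_factor kappa eps delta n /\
            achieves_in_expectation kappa P T n (alpha n)])
  /\
  (forall p : R, 0 < p ->
    ~ exists (P : program R) (T : nat -> nat) (alpha : nat -> R),
      [/\ polynomial_bound T, runs_in_time kappa P T &
          \forall n \near \oo,
            alpha n < hardness_factor kappa eps delta n /\
            achieves_with_probability kappa p P T n (alpha n)]).
Proof.
split=> [[P [T [alpha [Tpoly _ [N _ good]]]]]|p p0 [P [T [alpha [Tpoly _ [N _ good]]]]]].
(* This makes the expected cost at least [k - kappa / 2], against the guaranteed [k - kappa]. *)
- have eta0 : 0 < kappa / 2 by rewrite divr_gt0.
  have [k [b [s []]]] := hard_instance P kappa_gt0 kappa_le1 eps_gt0 delta_gt0 eta0
    Tpoly (fun n Nn => (good n Nn).1).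
  set E := complete_bipartite k; set f := hidden_cost _ _ _ _; set t := T _.
  move=> k0 Nk fE cheap [Y optY aY].
  have [pm /(_ Y optY) cost_le] := (good _ Nk).2 E f fE.
  have := expected_cost_ge fE pm; rewrite -/t -/E -/f => cost_ge.
  have t0 : (0 : R) < 2 ^+ t by rewrite exprn_gt0.
  have := le_trans cost_ge (ler_wpM2r (ltW t0) (le_trans cost_le aY)).
  move: cheap (mulr_gt0 kappa_gt0 t0).
  move: (2 ^+ t) (_ * #|_|%:R) => z c; clear; rewrite mulrBl; lra.
(* A success must be a cheap output, so its probability is at most [p / 2], as [k] is at least 1. *)
- have eta0 : 0 < p / 2 by rewrite divr_gt0.
  have [k [b [s []]]] := hard_instance P kappa_gt0 kappa_le1 eps_gt0 delta_gt0 eta0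
    Tpoly (fun n Nn => (good n Nn).1).
  set E := complete_bipartite k; set f := hidden_cost _ _ _ _; set t := T _.
  move=> k0 Nk fE cheap [Y optY aY].
  have p_le := (good _ Nk).2 E f fE Y optY.
  have bound_lt : alpha (k + k)%N * f Y < k%:R.
    by apply: le_lt_trans aY _; rewrite ltrBlDr ltrDl.
  have := le_trans p_le (@success_probability_le R kappa _ k b s P t bound_lt).
  have t0 : (0 : R) < 2 ^+ t by rewrite exprn_gt0.
  rewrite ler_pdivlMr // => pt.
  have k1 : (1 : R) <= k%:R by rewrite ler1n.
  have : p * 2 ^+ t <= p / 2 * 2 ^+ t.
    apply: le_trans cheap; apply: le_trans pt _.
    by rewrite ler_peMl.
  rewrite ler_pM2r //; move: p0; clear; lra.
Qed.
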